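(* The following hold: 1. $\widehat{\mathsf{G}}|_{\mathrm c}\equiv_{\mathrm{sW}}\mathsf{G}<_{\mathrm W}^{*}\widehat{\mathsf{G}}$, 2. $(\mathsf{G}\star\mathsf{G})|_{\mathrm c}\equiv_{\mathrm{sW}}\mathsf{G}$, 3. $\mathsf{G}^{*}\equiv_{\mathrm{sW}}\mathsf{G}$.
   Context: Weihrauch complexity. $f:\subseteq X\rightrightarrows Y$ denotes a partial multivalued map. A represented space $(X,\delta_X)$ is a set $X$ with a surjective partial map $\delta_X:\subseteq\mathbb N^{\mathbb N}\to X$. A partial function $F:\subseteq\mathbb N^{\mathbb N}\to\mathbb N^{\mathbb N}$ is a realizer of $f:\subseteq X\rightrightarrows Y$, written $F\vdash f$, if $\delta_YF(p)\in f(\delta_X(p))$ for all $p\in\mathrm{dom}(f\delta_X)$. A problem is a multivalued map on represented spaces that has a realizer. $\mathbb N^{\mathbb N}$, $\mathbb N$ and products carry the standard representations; $\langle\cdot\rangle$ denotes standard pairing/tupling (including pairings of $\mathbb N^{\mathbb N}\times\mathbb N$). $f\leq_{\mathrm W}g$ holds if there are computable $H,L:\subseteq\mathbb N^{\mathbb N}\to\mathbb N^{\mathbb N}$ such that $H\langle\mathrm{id},\Gamma L\rangle\vdash f$ whenever $\Gamma\vdash g$; $f\leq_{\mathrm{sW}}g$ holds if there are computable $H,L$ such that $H\Gamma L\vdash f$ whenever $\Gamma\vdash g$. $\leq_{\mathrm W}^{*}$ is defined as $\leq_{\mathrm W}$ but with $H,L$ only required to be continuous. $\equiv_{\mathrm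 W},\equiv_{\mathrm{sW}}$ are the corresponding equivalences, and $f<_{\mathrm W}^{*}g$ means $f\leq_{\mathrm W}^{*}g$ and $g\not\leq_{\mathrm W}^{*}f$. The Gödel problem. $\varphi$ is a fixed standard (acceptable) Gödel numbering of the partial computable functions $\subseteq\mathbb N\to\mathbb N$, and $\mathsf{G}:\subseteq\mathbb N^{\mathbb N}\rightrightarrows\mathbb N$, $\mathsf{G}(p)=\{i\in\mathbb N:\varphi_i=p\}$, with domain the set of all (total) computable sequences. Operations. - $f|_{\mathrm c}$ is the restriction of a problem $f$ to its computable instances. - Parallelization: $\widehat f$ maps a sequence $(x_n)_{n\in\mathbb N}$ in $\mathrm{dom}(f)$ to any sequence $(y_n)_{n\in\mathbb N}$ with $y_n\in f(x_n)$ for all $n$. - Finite parallelization: $f^{*}$ takes as input $n\in\mathbb N$ and $(x_1,\dots,x_n)\in\mathrm{dom}(f)^n$ and returns $n$ and any element of $f(x_1)\times\dots\times f(x_n)$. - Compositional product: $f\star g\equiv_{\mathrm W}\max_{\leq_{\mathrm W}}\{f_0\circ g_0:f_0\leq_{\mathrm W}f\text{ and }g_0\leq_{\mathrm W}g\}$, where composition of multivalued maps has domain $\mathrm{dom}(f_0\circ g_0)=\{x\in\mathrm{dom}(g_0):g_0(x)\subseteq\mathrm{dom}(f_0)\}$. As concrete representative, $\mathsf{G}\star\mathsf{G}$ is taken to be $\langle\mathrm{id}\times\mathsf{G}\rangle\circ F\circ\langle\mathrm{id}\times\mathsf{G}\rangle$ for a suitable fixed computable $F:\subseteq\mathbb N^{\mathbb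 N}\to\mathbb N^{\mathbb N}$, where $\langle\mathrm{id}\times\mathsf{G}\rangle\langle p,q\rangle=\{\langle p,i\rangle:i\in\mathsf{G}(q)\}$; one can take $F\langle\langle q,r\rangle,i\rangle:=\mathsf{U}\langle q,\langle r,i\rangle\rangle$ with $\mathsf{U}:\subseteq\mathbb N^{\mathbb N}\to\mathbb N^{\mathbb N}$ a standard computable universal function (the functions $\mathsf{U}\langle q,\cdot\rangle$, $q\in\mathbb N^{\mathbb N}$, form a standard effective enumeration which contains an extension of every continuous partial function on $\mathbb N^{\mathbb N}$, with computable $q$ for every computable function). $(\mathsf{G}\star\mathsf{G})|_{\mathrm c}$ is the restriction of this representative to computable inputs. *)

(* Defs.v *)
(* Written against Stdlib only. *)
From Stdlib Require Import Arith Lia List Cantor FunctionalExtensionality ClassicalEpsilon.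

Set Implicit Arguments.
Unset Strict Implicit.
Unset Printing Implicit Defensive.

(** * Partial functions, sequences and tupling *)

Record pfun (A B : Type) := Pfun {
  graph :> A -> B -> Prop;
  graph_fun : forall x y z, graph x y -> graph x z -> y = z
}.

Definition extends (A B : Type) (f g : A -> B -> Prop) : Prop :=
  forall x y, g x y -> f x y.

Definition baire := nat -> nat.

Definition code2 (x y : nat) : nat := Cantor.to_nat (x, y).
Definition left2 (n : nat) : nat := fst (Cantor.of_nat n).
Definition right2 (n : nat) : nat := snd (Cantor.of_nat n).

(* <p,q>, for p, q : N^N *)
Definition bpair (p q : baire) : baire :=
  fun n => if Nat.even n then p (Nat.div2 n) else q (Nat.div2 n).

(* <p,i>, for p : N^N and i : N; a bijection from N^N x N to N^N *)
Definition bcons (p : baire) (i : nat) : baire :=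
  fun n => match n with 0 => i | S m => p m end.
Definition btail (p : baire) : baire := fun n => p (S n).

(* <p_0,p_1,...>, and its inverse *)
Definition btuple (p : nat -> baire) : baire := fun n => p (left2 n) (right2 n).
Definition bsection (p : baire) (n : nat) : baire := fun m => p (code2 n m).

(** * Computability *)

(* mu-recursive programs with an oracle; all programs are unary, arguments
   being paired by Cantor's bijection. *)
Inductive code :=
| Zero | Succ | Fst | Snd | Oracle
| Pair (c d : code)
| Comp (c d : code)
| Prec (c d : code)
| Mu (c : code).

(* [prec_rel f g a n y]: y is the value at n of the function with
   h(0) = f(a) and h(m+1) = g(<a,<m,h(m)>>). *)
Fixpoint prec_rel (f g : nat -> nat -> Prop) (a n y : nat) : Prop :=
  match n with
  | 0 => f a y
  | S m => exists r, prec_rel f g a m r /\ g (code2 a (code2 m r)) y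
  end.

(* [eval o c x y]: with the (partial) oracle o, the program c halts on input x
   with output y. *)
Fixpoint eval (o : nat -> nat -> Prop) (c : code) (x y : nat) : Prop :=
  match c with
  | Zero => y = 0
  | Succ => y = S x
  | Fst => y = left2 x
  | Snd => y = right2 x
  | Oracle => o x y
  | Pair c d => exists a b, eval o c x a /\ eval o d x b /\ y = code2 a b
  | Comp c d => exists z, eval o d x z /\ eval o c z y
  | Prec c d => prec_rel (eval o c) (eval o d) (left2 x) (right2 x) y
  | Mu c => eval o c (code2 x y) 0 /\
            forall m, m < y -> exists k, eval o c (code2 x m) (S k)
  end.

(* Partial computable functions from N to N: the oracle is nowhere defined,
   so that oracle queries diverge. *)
Definition partial_computable (f : nat -> nat -> Prop) : Prop :=
  exists c, forall x y, f x y <-> eval (fun _ _ => False) c x y.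

Definition computable_seq (p : baire) : Prop :=
  partial_computable (fun n y => y = p n).

(* Type-2 computability: one program, using the input as oracle, computes the
   output on the whole domain; nothing is required outside of the domain. *)
Definition computable (F : pfun baire baire) : Prop :=
  exists c, forall p q, F p q -> forall n, eval (fun x y => y = p x) c n (q n).

(* Continuity on the domain, for the product topology of N^N. *)
Definition continuous (F : pfun baire baire) : Prop :=
  forall p q, F p q -> forall n, exists m,
  forall p' q', (forall k, k < m -> p' k = p k) -> F p' q' -> q' n = q n.

(* Acceptable Goedel numberings: the utm-theorem and the smn-theorem hold.
   The latter, applied to h<i,n> = f(n), shows that every partial computable
   function f has an index. *)
Definition acceptable (phi : nat -> pfun nat nat) : Prop :=
  partial_computable (fun x y => phi (left2 x) (right2 x) y) /\
  forall h : nat -> nat -> Prop, partial_computable h ->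
    exists s : nat -> nat, computable_seq s /\
      forall i n y, phi (s i) n y <-> h (code2 i n) y.

Definition universal (U : pfun baire baire) : Prop :=
  computable U /\
  (forall F : pfun baire baire, continuous F ->
     exists q, extends (fun p r => U (bpair q p) r) F) /\
  (forall F : pfun baire baire, computable F ->
     exists q, computable_seq q /\ extends (fun p r => U (bpair q p) r) F).

(** * Represented spaces *)

Record represented := Represented {
  point :> Type;
  rep : pfun baire point;
  rep_surj : forall x, exists p, rep p x
}.

Definition computable_point (X : represented) (x : X) : Prop :=
  exists p, computable_seq p /\ rep X p x.

Program Definition baire_space : represented :=
  {| point := baire; rep := {| graph := fun p q => p = q |} |}.
Next Obligation. eauto. Qed.

Program Definition nat_space : represented :=
  {| point := nat; rep := {| graph := fun p n => p 0 = n |} |}.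
Next Obligation. exists (fun _ => x); reflexivity. Qed.

Lemma bsection_btuple (p : nat -> baire) n : bsection (btuple p) n = p n.
Proof.
  apply functional_extensionality; intro m.
  unfold bsection, btuple, left2, right2, code2.
  now rewrite Cantor.cancel_of_to.
Qed.

(* X^N *)
Program Definition seq_space (X : represented) : represented :=
  {| point := nat -> X;
     rep := {| graph := fun p x => forall n, rep X (bsection p n) (x n) |} |}.
Next Obligation.
  apply functional_extensionality; intro n; eapply graph_fun; eauto.
Qed.
Next Obligation.
  exists (btuple (fun n => proj1_sig
    (constructive_indefinite_description _ (rep_surj (x n))))).
  intro n; rewrite bsection_btuple.
  now destruct (constructive_indefinite_description _ (rep_surj (x n))).
Qed.

(* X^*, the disjoint union of all X^n. A name of (x_0,...,x_{n-1}) is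
   <<p_0,p_1,...>,n> where p_i is a name of x_i for i < n and the other p_i
   are arbitrary. *)
Program Definition list_space (X : represented) : represented :=
  {| point := list X;
     rep := {| graph := fun p l => p 0 = length l /\
       forall i x, nth_error l i = Some x -> rep X (bsection (btail p) i) x |} |}.
Next Obligation.
  rename y into l, z into l'.
  apply nth_error_ext; intro i.
  destruct (nth_error l i) as [a|] eqn:E; destruct (nth_error l' i) as [b|] eqn:E'.
  - f_equal; eapply graph_fun; eauto.
  - apply nth_error_None in E'. assert (i < length l) by (apply nth_error_Some; congruence). lia.
  - apply nth_error_None in E. assert (i < length l') by (apply nth_error_Some; congruence). lia.
  - reflexivity.
Qed.
Next Obligation.
  rename x into l.
  exists (bcons (btuple (fun i => match nth_error l i with
    | Some x => proj1_sig (constructive_indefinite_description _ (rep_surj x))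
    | None => fun _ => 0 end)) (length l)).
  split; [reflexivity|]; intros i x E.
  change (btail (bcons ?p ?n)) with p.
  rewrite bsection_btuple, E.
  now destruct (constructive_indefinite_description _ (rep_surj x)).
Qed.

(** * Problems *)

(* Partial multivalued maps between represented spaces; x lies in the domain
   if and only if f x is inhabited. The existence of a realizer is automatic,
   see [problem_has_realizer]. *)
Record problem := Problem {
  src : represented;
  tgt : represented;
  mv :> src -> tgt -> Prop
}.

Definition realizes (F : pfun baire baire) (f : problem) : Prop :=
  forall p x, rep (src f) p x -> (exists y, f x y) ->
  exists q y, F p q /\ rep (tgt f) q y /\ f x y.

Lemma problem_has_realizer (f : problem) : exists F, realizes F f.
Proof.
  set (P := fun p q => exists x y, rep (src f) p x /\ rep (tgt f) q y /\ f x y).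
  unshelve eexists.
  - exists (fun p q => P p q /\ q = epsilon (inhabits p) (P p)).
    intros p q q' [_ ->] [_ ->]; reflexivity.
  - intros p x Hx [y Hy]; destruct (rep_surj y) as [q Hq].
    assert (H : exists q, P p q) by (exists q, x, y; auto).
    pose proof (epsilon_spec (inhabits p) (P p) H) as He.
    destruct He as (x' & y' & Hx' & Hy' & Hf).
    exists (epsilon (inhabits p) (P p)), y'.
    rewrite (graph_fun Hx Hx') in *.
    repeat split; auto; exists x', y'; auto.
Qed.

(** * Weihrauch reducibility *)

Program Definition pid : pfun baire baire := {| graph := fun p q => q = p |}.

Lemma pcomp_fun (F G : pfun baire baire) p r r' :
  (exists q, G p q /\ F q r) -> (exists q, G p q /\ F q r') -> r = r'.
Proof.
  intros [q [HG HF]] [q' [HG' HF']].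
  rewrite (graph_fun HG' HG) in HF'; eapply graph_fun; eauto.
Qed.

Definition pcomp (F G : pfun baire baire) : pfun baire baire :=
  {| graph := fun p r => exists q, G p q /\ F q r; graph_fun := @pcomp_fun F G |}.

(* <F,G> *)
Program Definition pfork (F G : pfun baire baire) : pfun baire baire :=
  {| graph := fun p r => exists q q', F p q /\ G p q' /\ r = bpair q q' |}.
Next Obligation. f_equal; eapply graph_fun; eauto. Qed.

Definition sW_le (f g : problem) : Prop :=
  exists H L, computable H /\ computable L /\
  forall Gamma, realizes Gamma g -> realizes (pcomp H (pcomp Gamma L)) f.

(* Topological version of Weihrauch reducibility: H and L are only continuous. *)
Definition W_le_cont (f g : problem) : Prop :=
  exists H L, continuous H /\ continuous L /\
  forall Gamma, realizes Gamma g -> realizes (pcomp H (pfork pid (pcomp Gamma L))) f.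

Definition sW_equiv (f g : problem) : Prop := sW_le f g /\ sW_le g f.
Definition W_lt_cont (f g : problem) : Prop := W_le_cont f g /\ ~ W_le_cont g f.

(** * Operations on problems *)

Definition restr_c (f : problem) : problem :=
  {| src := src f; tgt := tgt f;
     mv := fun x y => computable_point x /\ f x y |}.

Definition parallelization (f : problem) : problem :=
  {| src := seq_space (src f); tgt := seq_space (tgt f);
     mv := fun (x : nat -> src f) (y : nat -> tgt f) => forall n, f (x n) (y n) |}.

Definition finite_parallelization (f : problem) : problem :=
  {| src := list_space (src f); tgt := list_space (tgt f);
     mv := Forall2 f |}.

(* Composition of multivalued maps, with domain
   { x in dom(g) : g(x) is included in dom(f) }. *)
Definition mv_comp (A B C : Type) (f : B -> C -> Prop) (g : A -> B -> Prop)
  : A -> C -> Prop :=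
  fun x z => (forall y, g x y -> exists w, f y w) /\ exists y, g x y /\ f y z.

(** * The Goedel problem *)

Definition Goedel (phi : nat -> pfun nat nat) : problem :=
  {| src := baire_space; tgt := nat_space;
     mv := fun (p : baire) (i : nat) => forall n, phi i n (p n) |}.

Definition id_times_Goedel (phi : nat -> pfun nat nat) (a b : baire) : Prop :=
  exists p q i, a = bpair p q /\ b = bcons p i /\ Goedel phi q i.

(* F<<q,r>,i> = U<q,<r,i>> *)
Definition F_U (U : pfun baire baire) (a b : baire) : Prop :=
  exists q r i, a = bcons (bpair q r) i /\ U (bpair q (bcons r i)) b.

Definition Goedel_star_Goedel (phi : nat -> pfun nat nat) (U : pfun baire baire)
  : problem :=
  {| src := baire_space; tgt := baire_space;
     mv := mv_comp (id_times_Goedel phi) (mv_comp (F_U U) (id_times_Goedel phi)) |}.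

(* Main.v *)
Require Import Defs.
From Stdlib Require Import Arith Lia List FunctionalExtensionality ClassicalEpsilon.

(** An index of a computable sequence is at least as useful as the sequence
    itself: whatever a program produces from the oracle [p], an index of the
    product can be computed from an index of [p].  This is [smn_operator]; it
    follows from the utm-theorem, which lets oracle queries be answered by the
    universal function ([eval_relativize], [eval_from_index]), and the
    smn-theorem.  Hence a single index of a whole instance, which one call of
    the Goedel problem G provides, solves every instance built from copies of
    G that is computable as a whole.

    - Computable instances of the parallelization: the sections of a sequence
      are uniformly computable from it, hence so are their indices.
    - Finite parallelization: no computability restriction is needed, since
      finitely many computable sequences form one computable sequence, once the
      junk behind them in the name is erased ([first_sections_computable]).
      Only the index, and not the instance, is visible after the call, so the
      number of sequences is recovered by evaluating the index.
    - Computable instances [<<q,r>,s>] of the compositional product: from an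
      index of the instance, an index [i] of [s] is found.  Then
      [U<q,<r,i>>] is computed from the instance by one fixed program, so that
      the part that is passed on can be evaluated, and an index of the other
      part, which is the second question to G, can be found.

    In the other direction, G is a special case of each of these problems; for
    the product, [U] is run on an index of the identity, which hands the
    answer of the first call through to the output.

    The unrestricted parallelization is strictly harder than G, even
    topologically, because the answer of G is a single number.  A reduction
    would give a continuous [H] such that every sequence [x] of computable
    sequences has a number [i] for which [H<x,i>] lists indices of all [x n].
    There are only countably many [i], and they are defeated one after the
    other ([defeat]): if some admissible [x] that extends what is fixed so far
    makes [H<x,i>] answer on the first free sequence, then by continuity the
    answer depends on a finite part of [x], and the free sequence is changed
    beyond this part, so that the answer is wrong.  Finitely many whole
    sequences are fixed in each round, so every [x n] is computable in the
    limit, although [x] is not computable as a whole. *)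

Set Implicit Arguments.
Unset Strict Implicit.
Unset Printing Implicit Defensive.

(** * Oracle programs *)

Lemma left2_code2 x y : left2 (code2 x y) = x.
Proof. unfold left2, code2; now rewrite Cantor.cancel_of_to. Qed.

Lemma right2_code2 x y : right2 (code2 x y) = y.
Proof. unfold right2, code2; now rewrite Cantor.cancel_of_to. Qed.

Lemma code2_left2_right2 n : code2 (left2 n) (right2 n) = n.
Proof.
  unfold code2, left2, right2; rewrite <- surjective_pairing.
  apply Cantor.cancel_to_of.
Qed.

Lemma code2_ge_left x y : x <= code2 x y.
Proof. pose proof (Cantor.to_nat_non_decreasing x y); unfold code2; lia. Qed.

Lemma code2_ge_right x y : y <= code2 x y.
Proof. pose proof (Cantor.to_nat_non_decreasing x y); unfold code2; lia. Qed.

Lemma left2_le n : left2 n <= n.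
Proof. rewrite <- (code2_left2_right2 n) at 2; apply code2_ge_left. Qed.

#[local] Opaque code2 left2 right2.

Ltac code2_simpl :=
  repeat (rewrite ?left2_code2, ?right2_code2, ?code2_left2_right2 in *).

Definition seq_oracle (p : baire) : nat -> nat -> Prop := fun x y => y = p x.
Definition no_oracle : nat -> nat -> Prop := fun _ _ => False.

Lemma eval_mono (o o' : nat -> nat -> Prop) c :
  (forall x y, o x y -> o' x y) -> forall x y, eval o c x y -> eval o' c x y.
Proof.
  intros Ho; induction c as [| | | | |c IHc d IHd|c IHc d IHd|c IHc d IHd|c IHc];
    cbn [eval]; intros x y; auto.
  - intros (a & b & Ha & Hb & ->); exists a, b; auto.
  - intros (z & Hz & Hy); eauto.
  - generalize (left2 x) (right2 x) y; intros a n; induction n as [|n IHn]; cbn; auto.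
    intros z (r & Hr & Hz); eauto.
  - intros [H0 Hm]; split; auto.
    intros m Hlt; destruct (Hm m Hlt) as [k Hk]; eauto.
Qed.

Lemma eval_functional (o : nat -> nat -> Prop) c :
  (forall x y z, o x y -> o x z -> y = z) ->
  forall x y z, eval o c x y -> eval o c x z -> y = z.
Proof.
  intros Ho; induction c as [| | | | |c IHc d IHd|c IHc d IHd|c IHc d IHd|c IHc];
    cbn [eval]; intros x y z; try congruence; eauto.
  - intros (a & b & Ha & Hb & ->) (a' & b' & Ha' & Hb' & ->).
    f_equal; eauto.
  - intros (u & Hu & Hy) (u' & Hu' & Hz).
    rewrite (IHd _ _ _ Hu Hu') in Hy; eauto.
  - generalize (left2 x) (right2 x); intros a n; revert y z.
    induction n as [|n IHn]; cbn; eauto.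
    intros y z (r & Hr & Hy) (r' & Hr' & Hz).
    rewrite (IHn _ _ Hr Hr') in Hy; eauto.
  - intros [H0 Hm] [H0' Hm'].
    destruct (lt_eq_lt_dec y z) as [[Hlt|]|Hlt]; auto; exfalso.
    + destruct (Hm' _ Hlt) as [k Hk]; discriminate (IHc _ _ _ H0 Hk).
    + destruct (Hm _ Hlt) as [k Hk]; discriminate (IHc _ _ _ H0' Hk).
Qed.

(** One program computes [f k] from the oracle [O k], uniformly in [k].  For
    operators on Baire space, [K] is Baire space itself and [O] is
    [seq_oracle].  For a program that is only required to work under some
    promise on its oracle, such as a program that evaluates an index, [K] is
    the type of all data that satisfy the promise; on [K], the function to be
    computed is total, and the closure properties below need no partial
    functions. *)
Definition computes (K : Type) (O : K -> nat -> nat -> Prop) (f : K -> nat -> nat) :=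
  exists c, forall k x, eval (O k) c x (f k x).

Lemma computable_seq_program p :
  computable_seq p <-> exists c, forall x, eval no_oracle c x (p x).
Proof.
  split; intros [c Hc]; exists c.
  - intros x; now apply Hc.
  - intros x y; split; [intros ->; apply Hc|].
    intros Hy; apply (@eval_functional no_oracle c) with x; auto; intros ? ? ? [].
Qed.

(** * Closure properties of uniform computability *)

Section Closure.
Variables (K : Type) (O : K -> nat -> nat -> Prop).

(** The way in which the universal function of a numbering, the only partial
    ingredient, enters uniform computations. *)
Lemma computes_eval c (f g : K -> nat -> nat) :
  (forall k x, eval no_oracle c (g k x) (f k x)) -> computes O g -> computes O f.
Proof.
  intros Hc [d Hd]; exists (Comp c d); intros k x; cbn; exists (g k x); split; auto.
  eapply eval_mono; [|apply Hc]; intros ? ? [].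
Qed.

Lemma computes_seq s (g : K -> nat -> nat) :
  computable_seq s -> computes O g -> computes O (fun k x => s (g k x)).
Proof.
  intros Hs; apply computable_seq_program in Hs; destruct Hs as [c Hc].
  now apply computes_eval with c.
Qed.

Lemma computes_id : computes O (fun _ x => x).
Proof.
  exists (Pair Fst Snd); intros k x; cbn; exists (left2 x), (right2 x).
  now code2_simpl.
Qed.

Lemma computes_succ (g : K -> nat -> nat) :
  computes O g -> computes O (fun k x => S (g k x)).
Proof. intros [d Hd]; exists (Comp Succ d); intros k x; cbn; eauto. Qed.

Lemma computes_const n : computes O (fun _ _ => n).
Proof.
  induction n; [|now apply computes_succ].
  now exists Zero.
Qed.

Lemma computes_left (g : K -> nat -> nat) :
  computes O g -> computes O (fun k x => left2 (g k x)).
Proof. intros [d Hd]; exists (Comp Fst d); intros k x; cbn; eauto. Qed.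

Lemma computes_right (g : K -> nat -> nat) :
  computes O g -> computes O (fun k x => right2 (g k x)).
Proof. intros [d Hd]; exists (Comp Snd d); intros k x; cbn; eauto. Qed.

Lemma computes_oracle (q : K -> baire) (g : K -> nat -> nat) :
  (forall k, O k = seq_oracle (q k)) ->
  computes O g -> computes O (fun k x => q k (g k x)).
Proof.
  intros HO [d Hd]; exists (Comp Oracle d); intros k x; cbn.
  exists (g k x); split; auto; now rewrite HO.
Qed.

Lemma computes_code2 (f g : K -> nat -> nat) :
  computes O f -> computes O g -> computes O (fun k x => code2 (f k x) (g k x)).
Proof. intros [c Hc] [d Hd]; exists (Pair c d); intros k x; cbn; eauto 6. Qed.

Lemma computes_comp (f g : K -> nat -> nat) :
  computes O f -> computes O g -> computes O (fun k x => f k (g k x)).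
Proof. intros [c Hc] [d Hd]; exists (Comp c d); intros k x; cbn; eauto. Qed.

(** All the arithmetic below is obtained from this scheme; [b] sees the argument
    [x], the stage [m] and the previous value [h] in one coded triple. *)
Lemma computes_rec (n a : K -> nat -> nat) (b : K -> nat -> nat) :
  computes O n -> computes O a -> computes O b ->
  computes O (fun k x => nat_rect (fun _ => nat) (a k x)
                (fun m h => b k (code2 x (code2 m h))) (n k x)).
Proof.
  intros [cn Hn] [ca Ha] [cb Hb].
  destruct computes_id as [ci Hi].
  exists (Comp (Prec ca cb) (Pair ci cn)); intros k x; cbn.
  exists (code2 x (n k x)); split; [eauto 6|]; code2_simpl.
  induction (n k x); cbn; eauto.
Qed.

Lemma computes_pred (g : K -> nat -> nat) :
  computes O g -> computes O (fun k x => pred (g k x)).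
Proof.
  intros Hg.
  destruct (computes_rec Hg (computes_const 0)
    (computes_left (computes_right computes_id))) as [c Hc].
  exists c; intros k x; specialize (Hc k x).
  destruct (g k x); cbn in *; code2_simpl; auto.
Qed.

Lemma computes_sub (f g : K -> nat -> nat) :
  computes O f -> computes O g -> computes O (fun k x => f k x - g k x).
Proof.
  intros Hf Hg.
  destruct (computes_rec Hg Hf
    (computes_pred (computes_right (computes_right computes_id)))) as [c Hc].
  exists c; intros k x; specialize (Hc k x); cbn in Hc.
  replace (f k x - g k x) with
    (nat_rect (fun _ => nat) (f k x)
       (fun m h => pred (right2 (right2 (code2 x (code2 m h))))) (g k x)); auto.
  generalize (f k x) (g k x); intros a n; induction n; cbn; [lia|].
  rewrite IHn; code2_simpl; lia.
Qed.

Lemma computes_double (g : K -> nat -> nat) :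
  computes O g -> computes O (fun k x => 2 * g k x).
Proof.
  intros Hg.
  destruct (computes_rec Hg (computes_const 0)
    (computes_succ (computes_succ (computes_right (computes_right computes_id)))))
    as [c Hc].
  exists c; intros k x; specialize (Hc k x); cbn [eval] in Hc.
  replace (2 * g k x) with
    (nat_rect (fun _ => nat) 0
       (fun m h => S (S (right2 (right2 (code2 x (code2 m h)))))) (g k x)); auto.
  generalize (g k x); intros n; induction n; cbn [nat_rect]; [lia|].
  rewrite IHn; code2_simpl; lia.
Qed.

Definition decides (t : K -> nat -> bool) := computes O (fun k x => Nat.b2n (t k x)).

(** The recursion scheme runs both branches when the test succeeds, so the
    branches must be total; the choice of [K] ensures that they are. *)
Lemma computes_if (t : K -> nat -> bool) (f g : K -> nat -> nat) :
  decides t -> computes O f -> computes O g ->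
  computes O (fun k x => if t k x then f k x else g k x).
Proof.
  intros Ht Hf Hg.
  destruct (computes_rec Ht Hg (computes_comp Hf (computes_left computes_id)))
    as [c Hc].
  exists c; intros k x; specialize (Hc k x).
  destruct (t k x); cbn in Hc; code2_simpl; auto.
Qed.

Lemma decides_zero (g : K -> nat -> nat) :
  computes O g -> decides (fun k x => g k x =? 0).
Proof.
  intros Hg; destruct (computes_sub (computes_const 1) Hg) as [c Hc].
  exists c; intros k x; specialize (Hc k x).
  now destruct (g k x) as [|[|n]].
Qed.

Lemma decides_even (g : K -> nat -> nat) :
  computes O g -> decides (fun k x => Nat.even (g k x)).
Proof.
  intros Hg.
  destruct (computes_rec Hg (computes_const 1)
    (computes_sub (computes_const 1) (computes_right (computes_right computes_id))))
    as [c Hc].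
  exists c; intros k x; specialize (Hc k x); cbn [eval] in Hc.
  replace (Nat.b2n (Nat.even (g k x))) with
    (nat_rect (fun _ => nat) 1
       (fun m h => 1 - right2 (right2 (code2 x (code2 m h)))) (g k x)); auto.
  generalize (g k x); intros n; induction n; cbn [nat_rect]; auto.
  rewrite IHn, Nat.even_succ, <- Nat.negb_even; code2_simpl.
  now destruct (Nat.even n).
Qed.

Lemma computes_div2 (g : K -> nat -> nat) :
  computes O g -> computes O (fun k x => Nat.div2 (g k x)).
Proof.
  intros Hg.
  pose proof (computes_right computes_id) as Hr.
  destruct (computes_rec Hg (computes_const 0)
    (computes_if (decides_even (computes_left Hr)) (computes_right Hr)
       (computes_succ (computes_right Hr)))) as [c Hc].
  exists c; intros k x; specialize (Hc k x); cbn beta in Hc.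
  match type of Hc with eval _ _ _ ?v => replace (Nat.div2 (g k x)) with v; auto end.
  generalize (g k x); intros n; induction n; cbn [nat_rect]; auto.
  rewrite IHn; code2_simpl; destruct (Nat.even n) eqn:E.
  - apply Nat.even_spec in E; destruct E as [m ->].
    now rewrite Nat.div2_succ_double, Nat.div2_double.
  - apply (f_equal negb) in E; rewrite Nat.negb_even in E; apply Nat.odd_spec in E.
    destruct E as [m ->]; replace (S (2 * m + 1)) with (2 * S m) by lia.
    rewrite Nat.add_1_r, Nat.div2_succ_double, Nat.div2_double; auto.
Qed.

Lemma computes_bcons (p : K -> nat -> baire) (i n : K -> nat -> nat) :
  computes O n -> computes O i -> computes O (fun k x => p k x (pred (n k x))) ->
  computes O (fun k x => bcons (p k x) (i k x) (n k x)).
Proof.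
  intros Hn Hi Hp.
  destruct (computes_if (decides_zero Hn) Hi Hp) as [c Hc].
  exists c; intros k x; specialize (Hc k x); now destruct (n k x).
Qed.

Lemma computes_bpair (p q : K -> nat -> baire) (n : K -> nat -> nat) :
  computes O n ->
  computes O (fun k x => p k x (Nat.div2 (n k x))) ->
  computes O (fun k x => q k x (Nat.div2 (n k x))) ->
  computes O (fun k x => bpair (p k x) (q k x) (n k x)).
Proof. intros Hn Hp Hq; exact (computes_if (decides_even Hn) Hp Hq). Qed.

Lemma computes_if_lt (f g a b : K -> nat -> nat) :
  computes O f -> computes O g -> computes O a -> computes O b ->
  computes O (fun k x => if f k x <? g k x then a k x else b k x).
Proof.
  intros Hf Hg Ha Hb.
  destruct (computes_if (decides_zero (computes_sub Hg Hf)) Hb Ha) as [c Hc].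
  exists c; intros k x; specialize (Hc k x); cbn beta in Hc.
  destruct (Nat.ltb_spec (f k x) (g k x)), (Nat.eqb_spec (g k x - f k x) 0);
    auto; lia.
Qed.

Lemma computes_if_eq (f g a b : K -> nat -> nat) :
  computes O f -> computes O g -> computes O a -> computes O b ->
  computes O (fun k x => if f k x =? g k x then a k x else b k x).
Proof.
  intros Hf Hg Ha Hb.
  destruct (computes_if_lt Hf Hg Hb (computes_if_lt Hg Hf Hb Ha)) as [c Hc].
  exists c; intros k x; specialize (Hc k x); cbn beta in Hc.
  destruct (Nat.eqb_spec (f k x) (g k x)), (Nat.ltb_spec (f k x) (g k x)),
    (Nat.ltb_spec (g k x) (f k x)); auto; lia.
Qed.

End Closure.

Lemma computes_seq_oracle (g : baire -> nat -> nat) :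
  computes seq_oracle g -> computes seq_oracle (fun p x => p (g p x)).
Proof. now apply computes_oracle with (q := fun p => p). Qed.

Lemma computable_seq_computes p :
  computes (fun _ : unit => no_oracle) (fun _ => p) -> computable_seq p.
Proof.
  intros [c Hc]; apply computable_seq_program; exists c; exact (Hc tt).
Qed.

Ltac computability :=
  repeat first
  [ eassumption
  | apply computes_id | apply computes_const
  | apply computes_double | apply computes_succ | apply computes_pred | apply computes_left
  | apply computes_right | apply computes_code2
  | apply computes_div2 | apply computes_bcons | apply computes_bpair
  | apply computes_if_lt | apply computes_if_eq | apply computes_seq_oracle
  | (apply computes_seq; [assumption|]) ].

(** * Answering oracle queries by a program *)

Definition reassoc : code := Pair (Comp Fst Fst) (Pair (Comp Snd Fst) Snd).

Lemma eval_reassoc o k x y z :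
  eval o reassoc (code2 (code2 k x) y) z <-> z = code2 k (code2 x y).
Proof.
  split.
  - cbn.
    intros (? & ? & (? & -> & ->) & (? & ? & (? & -> & ->) & -> & ->) & ->).
    now code2_simpl.
  - intros ->; cbn; exists k, (code2 x y); code2_simpl.
    repeat split; [|exists x, y; repeat split; auto]; eexists; split; eauto;
      now code2_simpl.
Qed.

(** The program [c], with its queries answered by [d].  As [d] depends on a
    parameter [k], an input [x] becomes [code2 k x] throughout; recursion and
    minimization add data on the right of their input, which [reassoc] moves
    below the parameter. *)
Fixpoint relativize (d c : code) : code :=
  match c with
  | Zero => Zero
  | Succ => Comp Succ Snd
  | Fst => Comp Fst Snd
  | Snd => Comp Snd Snd
  | Oracle => d
  | Pair a b => Pair (relativize d a) (relativize d b)
  | Comp a b => Comp (relativize d a) (Pair Fst (relativize d b))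
  | Prec a b =>
      Comp (Prec (relativize d a) (Comp (relativize d b) reassoc))
           (Pair (Pair Fst (Comp Fst Snd)) (Comp Snd Snd))
  | Mu a => Mu (Comp (relativize d a) reassoc)
  end.

(** An implication suffices where an equivalence might be expected: programs are
    deterministic, and only total results are ever asked for. *)
Lemma eval_relativize (o o' : nat -> nat -> Prop) d k c :
  (forall x y, o' x y -> eval o d (code2 k x) y) ->
  forall x y, eval o' c x y -> eval o (relativize d c) (code2 k x) y.
Proof.
  intros Ho; induction c as [| | | | |a IHa b IHb|a IHa b IHb|a IHa b IHb|a IHa];
    cbn [eval relativize]; intros x y; auto.
  1-3: intros ->; eexists; split; eauto; now code2_simpl.
  - intros (u & v & Hu & Hv & ->); exists u, v; auto.
  - intros (z & Hz & Hy); exists (code2 k z); split; auto.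
    exists k, z; code2_simpl; auto.
  - intros Hy; exists (code2 (code2 k (left2 x)) (right2 x)); split.
    + exists (code2 k (left2 x)), (right2 x); repeat split.
      * exists k, (left2 x); code2_simpl; repeat split.
        eexists; split; eauto; now code2_simpl.
      * eexists; split; eauto; now code2_simpl.
    + code2_simpl; revert y Hy; generalize (left2 x) (right2 x); intros u n.
      induction n as [|n IHn]; cbn [prec_rel]; auto.
      intros y (r & Hr & Hy); exists r; split; auto.
      cbn [eval]; eexists; split; [apply eval_reassoc; reflexivity|auto].
  - intros [H0 Hm]; split.
    + eexists; split; [apply eval_reassoc; reflexivity|auto].
    + intros m Hlt; destruct (Hm m Hlt) as [j Hj]; exists j.
      eexists; split; [apply eval_reassoc; reflexivity|auto].
Qed.

(** * Acceptable numberings *)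

Section Numbering.
Variable phi : nat -> pfun nat nat.
Hypothesis Hphi : acceptable phi.

(** Relative computations can be carried out without oracle from an index of
    the oracle: queries are answered by the utm-theorem. *)
Lemma eval_from_index c : exists c', forall e p,
  (forall n, phi e n (p n)) ->
  forall x y, eval (seq_oracle p) c x y -> eval no_oracle c' (code2 e x) y.
Proof.
  destruct Hphi as [[u Hu] _].
  exists (relativize u c); intros e p Hp; apply eval_relativize.
  intros x y ->; apply Hu; code2_simpl; apply Hp.
Qed.

(** The key to all reductions to the Goedel problem.  The parameter [k] allows a
    program to describe countably many sequences at once. *)
Lemma smn_operator c : exists s, computable_seq s /\ forall e p k q,
  (forall n, phi e n (p n)) ->
  (forall n, eval (seq_oracle p) c (code2 k n) (q n)) ->
  forall n, phi (s (code2 e k)) n (q n).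
Proof.
  destruct (eval_from_index c) as [c' Hc'].
  destruct Hphi as [_ smn].
  destruct (smn (eval no_oracle (Comp c' reassoc))) as (s & Hs & Hsp).
  { exists (Comp c' reassoc); reflexivity. }
  exists s; split; auto; intros e p k q Hp Hq n.
  apply Hsp; cbn [eval]; eexists; split; [apply eval_reassoc; reflexivity|eauto].
Qed.

Lemma computable_index p : computable_seq p -> exists i, forall n, phi i n (p n).
Proof.
  intros Hp; destruct Hphi as [_ smn].
  apply computable_seq_program in Hp; destruct Hp as [c Hc].
  destruct (smn (eval no_oracle (Comp c Snd))) as (s & _ & Hs).
  { exists (Comp c Snd); reflexivity. }
  exists (s 0); intros n; apply Hs; cbn; eexists; split; eauto; code2_simpl; auto.
Qed.

Lemma index_computable p i : (forall n, phi i n (p n)) -> computable_seq p.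
Proof.
  intros Hp; destruct (@eval_from_index Oracle) as [c Hc].
  apply computable_seq_computes.
  apply computes_eval with c (fun _ x => code2 i x); [|computability].
  intros _ x; apply Hc with p; auto; reflexivity.
Qed.

End Numbering.

(** * Reductions by programs *)

Lemma seq_oracle_functional p x y z : seq_oracle p x y -> seq_oracle p x z -> y = z.
Proof. congruence. Qed.

(** A program computes on its natural domain, where its output is unique.  So it
    suffices to exhibit programs and to say what they do on relevant inputs,
    and no domain has to be chosen for the functions of a reduction. *)
Lemma machine_fun c (p q r : baire) :
  (forall n, eval (seq_oracle p) c n (q n)) ->
  (forall n, eval (seq_oracle p) c n (r n)) -> q = r.
Proof.
  intros Hq Hr; apply functional_extensionality; intros n.
  apply (eval_functional (@seq_oracle_functional p) (Hq n) (Hr n)).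
Qed.

Definition machine (c : code) : pfun baire baire :=
  {| graph := fun p q => forall n, eval (seq_oracle p) c n (q n);
     graph_fun := @machine_fun c |}.

Lemma sW_le_of_programs (f g : problem) (cH cL : code) :
  (forall p x, rep (src f) p x -> (exists y, f x y) ->
     exists p' x', machine cL p p' /\ rep (src g) p' x' /\ (exists y', g x' y') /\
     forall q' y', rep (tgt g) q' y' -> g x' y' ->
       exists q y, machine cH q' q /\ rep (tgt f) q y /\ f x y) ->
  sW_le f g.
Proof.
  intros H; exists (machine cH), (machine cL).
  repeat split; [exists cH; auto|exists cL; auto|].
  intros Gamma HG p x Hp Hx.
  destruct (H p x Hp Hx) as (p' & x' & HL & Hp' & Hx' & HH).
  destruct (HG p' x' Hp' Hx') as (q' & y' & Hq' & Hy' & Hg).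
  destruct (HH q' y' Hy' Hg) as (q & y & Hq & Hy & Hf).
  exists q, y; repeat split; auto.
  exists q'; split; auto; exists p'; auto.
Qed.

(** * Tuples of sequences *)

Lemma btail_bcons p i : btail (bcons p i) = p.
Proof. reflexivity. Qed.

Lemma bcons_inj p q i j : bcons p i = bcons q j -> p = q /\ i = j.
Proof.
  intros E; split; [exact (f_equal btail E)|exact (f_equal (fun r => r 0) E)].
Qed.

Definition beven (p : baire) : baire := fun n => p (2 * n).
Definition bodd (p : baire) : baire := fun n => p (S (2 * n)).

Lemma beven_bpair p q : beven (bpair p q) = p.
Proof.
  apply functional_extensionality; intros n; unfold beven, bpair.
  now rewrite Nat.even_even, Nat.div2_double.
Qed.

Lemma bodd_bpair p q : bodd (bpair p q) = q.
Proof.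
  apply functional_extensionality; intros n; unfold bodd, bpair.
  rewrite Nat.even_succ, Nat.div2_succ_double, <- Nat.negb_even.
  now rewrite Nat.even_even.
Qed.

Lemma bpair_inj p q p' q' : bpair p q = bpair p' q' -> p = p' /\ q = q'.
Proof.
  intros E; split.
  - now rewrite <- (beven_bpair p q), E, beven_bpair.
  - now rewrite <- (bodd_bpair p q), E, bodd_bpair.
Qed.

Lemma bsection_inj p q : (forall n, bsection p n = bsection q n) -> p = q.
Proof.
  intros E; apply functional_extensionality; intros n.
  rewrite <- (code2_left2_right2 n); exact (f_equal (fun r => r (right2 n)) (E (left2 n))).
Qed.

Lemma bpair_computable p q :
  computable_seq p -> computable_seq q -> computable_seq (bpair p q).
Proof.
  intros Hp Hq; apply computable_seq_computes.
  apply computes_bpair with (p := fun _ _ => p) (q := fun _ _ => q); computability.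
Qed.

Definition constant (i : nat) : baire := fun _ => i.

Lemma constant_computable i : computable_seq (constant i).
Proof. apply computable_seq_computes; apply (computes_const _ i). Qed.

(** * Parallelization and finite parallelization *)

Section Reductions.
Variable phi : nat -> pfun nat nat.
Hypothesis Hphi : acceptable phi.

Lemma parallelization_c_le_Goedel :
  sW_le (restr_c (parallelization (Goedel phi))) (Goedel phi).
Proof.
  destruct (smn_operator Hphi Oracle) as (s & Hs & Hsp).
  assert (computes seq_oracle (fun q k => s (code2 (q 0) (left2 k)))) as [cH HH]
    by computability.
  apply sW_le_of_programs with cH Oracle.
  intros p x Hp (_ & (p' & Hp' & Hx) & _); cbn in x, Hp, Hx |- *.
  assert (p = p') as <- by (apply bsection_inj; intros n; rewrite Hp; auto).
  exists p, p; repeat split; auto.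
  { apply computable_index; auto. }
  intros q i <- Hi.
  exists (fun k => s (code2 (q 0) (left2 k))), (fun n => s (code2 (q 0) n)).
  repeat split; auto.
  - intros n; unfold bsection; now code2_simpl.
  - exists p; auto.
  - intros n; rewrite <- Hp; intros m.
    apply Hsp with p; auto; intros k; reflexivity.
Qed.

Lemma Goedel_le_parallelization_c :
  sW_le (Goedel phi) (restr_c (parallelization (Goedel phi))).
Proof.
  assert (computes seq_oracle (fun p k => p (right2 k))) as [cL HL] by computability.
  assert (computes seq_oracle (fun q (_ : nat) => q (code2 0 0))) as [cH HH]
    by computability.
  apply sW_le_of_programs with cH cL.
  intros p x -> [i Hi]; cbn in x, Hi |- *.
  exists (btuple (fun _ => x)), (fun _ => x); repeat split; auto.
  - apply bsection_btuple.
  - exists (fun _ => i); split; auto.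
    exists (btuple (fun _ => x)); split; [|intros n; apply bsection_btuple].
    apply index_computable with (phi := phi) (i := i) in Hi; auto.
    apply computable_seq_computes; unfold btuple; computability.
  - intros q y Hq [_ Hy].
    exists (fun _ => q (code2 0 0)), (y 0); repeat split; auto.
    exact (Hq 0).
Qed.

Lemma Goedel_le_finite_parallelization :
  sW_le (Goedel phi) (finite_parallelization (Goedel phi)).
Proof.
  assert (computes seq_oracle (fun p => bcons (fun k => p (right2 k)) 1)) as [cL HL].
  { apply computes_bcons with (p := fun p _ k => p (right2 k)); computability. }
  assert (computes seq_oracle (fun q (_ : nat) => q (S (code2 0 0)))) as [cH HH]
    by computability.
  apply sW_le_of_programs with cH cL.
  intros p x -> [i Hi]; cbn in x, Hi |- *.
  exists (bcons (btuple (fun _ => x)) 1), (x :: nil); repeat split; auto.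
  - intros [|[|n]] y [= <-]; apply bsection_btuple.
  - exists (i :: nil); repeat constructor; auto.
  - intros q l [_ Hq] Hl.
    inversion Hl as [|? y ? l' Hy Hl' E1 E2]; subst.
    exists (fun _ => q (S (code2 0 0))), y; repeat split; auto.
    exact (Hq 0 y eq_refl).
Qed.

(** A name of a list of [n] sequences may continue with arbitrary, possibly
    non-computable data, which is replaced by zeros here. *)
Definition first_sections (n : nat) (p : baire) : baire :=
  fun k => if left2 k <? n then p k else 0.

(** The programs of the [n] sections are glued by a case distinction; this is
    not uniform in the sections, but only existence is claimed. *)
Lemma first_sections_computable n p :
  (forall i, i < n -> computable_seq (bsection p i)) ->
  computable_seq (first_sections n p).
Proof.
  induction n as [|n IHn]; intros Hp.
  - apply computable_seq_computes; apply (computes_const _ 0).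
  - assert (computable_seq (first_sections n p)) as Hn by auto.
    assert (computable_seq (bsection p n)) as Hpn by auto.
    apply computable_seq_computes.
    replace (first_sections (S n) p) with
      (fun k => if left2 k =? n then bsection p n (right2 k) else first_sections n p k).
    { revert Hn Hpn; generalize (first_sections n p) (bsection p n); intros.
      computability. }
    apply functional_extensionality; intros k; unfold first_sections, bsection.
    destruct (Nat.eqb_spec (left2 k) n) as [<-|E].
    + rewrite code2_left2_right2; destruct (Nat.ltb_spec (left2 k) (S (left2 k)));
        auto; lia.
    + destruct (Nat.ltb_spec (left2 k) n), (Nat.ltb_spec (left2 k) (S n)); auto; lia.
Qed.

Lemma Forall2_map_seq (A B : Type) (f : A -> B -> Prop) (g : nat -> B) l :
  (forall i x, nth_error l i = Some x -> f x (g i)) ->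
  Forall2 f l (map g (seq 0 (length l))).
Proof.
  revert g; induction l as [|x l IHl]; intros g Hg; cbn; constructor.
  - now apply (Hg 0).
  - rewrite <- seq_shift, map_map; apply IHl; intros i y; apply (Hg (S i)).
Qed.

Lemma Forall2_nth_error_l (A B : Type) (f : A -> B -> Prop) l l' i x :
  Forall2 f l l' -> nth_error l i = Some x -> exists y, f x y.
Proof.
  intros H; revert i; induction H; intros [|i]; cbn; try discriminate; eauto.
  intros [= <-]; eauto.
Qed.

Lemma finite_parallelization_le_Goedel :
  sW_le (finite_parallelization (Goedel phi)) (Goedel phi).
Proof.
  assert (computes (fun _ : unit => no_oracle) (fun _ => S)) as [cS HS]
    by computability.
  destruct (smn_operator Hphi (Comp Oracle cS)) as (s & Hs & Hsp).
  destruct (eval_from_index Hphi Oracle) as [c Hc].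
  assert (computes seq_oracle
    (fun p => bcons (first_sections (p 0) (btail p)) (p 0))) as [cL HL].
  { apply computes_bcons with (p := fun p _ => first_sections (p 0) (btail p));
      unfold first_sections, btail; computability. }
  (* [fst z] is a name of an index and [snd z] the value at 0 of the sequence
     with this index, which is the length of the list. *)
  pose (K := {z : baire * nat | eval no_oracle c (code2 (fst z 0) 0) (snd z)}).
  pose (O := fun z : K => seq_oracle (fst (proj1_sig z))).
  assert (computes O (fun z => bcons
    (fun k => s (code2 (fst (proj1_sig z) 0) (left2 k))) (snd (proj1_sig z))))
    as [cH HH].
  { assert (computes O (fun z _ => fst (proj1_sig z) 0)) as H0.
    { apply computes_oracle with (q := fun z : K => fst (proj1_sig z)); auto.
      computability. }
    apply computes_bcons with
      (p := fun (z : K) _ k => s (code2 (fst (proj1_sig z) 0) (left2 k)));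
      computability.
    apply computes_eval with c (fun z _ => code2 (fst (proj1_sig z) 0) 0);
      [|computability].
    intros [z Hz] _; exact Hz. }
  apply sW_le_of_programs with cH cL.
  intros p x [Hlen Hp] [y Hy]; cbn in x, Hlen, Hp, Hy |- *.
  set (p' := bcons (first_sections (p 0) (btail p)) (p 0)).
  exists p', p'; repeat split; auto.
  - apply computable_index; auto.
    assert (computable_seq (first_sections (p 0) (btail p))).
    { apply first_sections_computable; intros i Hi; rewrite Hlen in Hi.
      destruct (nth_error x i) as [a|] eqn:E; [|now apply nth_error_None in E; lia].
      rewrite (Hp i a E).
      destruct (Forall2_nth_error_l Hy E) as [j Hj].
      exact (index_computable Hphi Hj). }
    apply computable_seq_computes.
    apply computes_bcons with (p := fun _ _ => first_sections (p 0) (btail p));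
      [computability..|].
    apply computes_seq; computability.
  - intros q i <- Hi.
    assert (eval no_oracle c (code2 (q 0) 0) (p' 0)) as E.
    { apply Hc with p'; auto; reflexivity. }
    specialize (HH (exist _ (q, p' 0) E)); cbn in HH.
    exists (bcons (fun k => s (code2 (q 0) (left2 k))) (p 0)),
      (map (fun n => s (code2 (q 0) n)) (seq 0 (length x))).
    repeat split; auto.
    + cbn; now rewrite length_map, length_seq.
    + intros n j Hj; rewrite btail_bcons; unfold bsection; code2_simpl.
      rewrite nth_error_map in Hj.
      destruct (nth_error (seq 0 (length x)) n) as [m|] eqn:Em; [|discriminate].
      injection Hj as <-.
      apply nth_error_nth with (d := 0) in Em as Em'.
      rewrite seq_nth in Em'; [now rewrite <- Em'|].
      rewrite <- (length_seq (length x) 0); apply nth_error_Some; congruence.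
    + apply Forall2_map_seq; intros n a E' m.
      apply Hsp with p'; auto; intros m'; cbn; eexists.
      split; [exact (eval_mono (fun _ _ (f : False) => match f with end) (HS tt _))|].
      unfold seq_oracle, p', bcons, first_sections; code2_simpl.
      rewrite <- (Hp n a E'); unfold bsection.
      destruct (Nat.ltb_spec n (p 0)) as [|Hge]; auto.
      rewrite Hlen in Hge; apply nth_error_None in Hge; congruence.
Qed.

End Reductions.

(** * The compositional product *)

Section CompositionalProduct.
Variables (phi : nat -> pfun nat nat) (U : pfun baire baire).
Hypotheses (Hphi : acceptable phi) (HU : universal U).

(** The instance asks [p] first and lets [U] apply the identity to [<0,i>], for
    the answer [i].  Now [<0,i>], read as a pair of sequences, is
    [<<0,i>,0>]: the second call is about the zero sequence, and [i] survives
    in the part that is passed on. *)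
Lemma Goedel_le_star_c :
  sW_le (Goedel phi) (restr_c (Goedel_star_Goedel phi U)).
Proof.
  destruct HU as (_ & _ & HUc).
  destruct (HUc pid) as (q0 & Hq0 & Hid); [exists Oracle; now intros p q ->|].
  pose (zero := constant 0).
  pose proof (constant_computable 0 : computable_seq zero) as Hzero.
  pose proof (bpair_computable Hq0 Hzero) as Hq0z.
  assert (computes seq_oracle (fun p => bpair (bpair q0 zero) p)) as [cL HL].
  { apply computes_bpair with (p := fun _ _ => bpair q0 zero) (q := fun p _ => p);
      [computability|apply computes_seq; computability|computability]. }
  assert (computes seq_oracle (fun r (_ : nat) => r 1)) as [cH HH] by computability.
  apply sW_le_of_programs with cH cL.
  intros p x -> [j Hj]; cbn [Goedel mv src tgt] in Hj.
  set (a := bpair (bpair q0 zero) x).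
  assert (Hcx : computable_seq x) by exact (index_computable Hphi Hj).
  assert (Ha : forall v, id_times_Goedel phi a v <->
    exists i, v = bcons (bpair q0 zero) i /\ Goedel phi x i).
  { intros v; split.
    - intros (p & q & i & E & -> & Hi).
      apply bpair_inj in E; destruct E as [<- <-]; eauto.
    - intros (i & -> & Hi); exists (bpair q0 zero), x, i; auto. }
  assert (HF : forall i w, F_U U (bcons (bpair q0 zero) i) w <-> w = bcons zero i).
  { assert (H : forall i, U (bpair q0 (bcons zero i)) (bcons zero i)) by
      (intros i; apply Hid; reflexivity).
    intros i w; split.
    - intros (q & r & i' & E & Hw).
      apply bcons_inj in E; destruct E as [E <-].
      apply bpair_inj in E; destruct E as [<- <-].
      exact (graph_fun Hw (H i)).
    - intros ->; exists q0, zero, i; auto. }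
  assert (Hin : forall w, mv_comp (F_U U) (id_times_Goedel phi) a w <->
    exists i, w = bcons zero i /\ Goedel phi x i).
  { intros w; split.
    - intros (_ & v & Hv & Hw); apply Ha in Hv; destruct Hv as (i & -> & Hi).
      apply HF in Hw; eauto.
    - intros (i & -> & Hi); split.
      + intros v Hv; apply Ha in Hv; destruct Hv as (i' & -> & _).
        exists (bcons zero i'); now apply HF.
      + exists (bcons (bpair q0 zero) i); split; [apply Ha; eauto|now apply HF]. }
  assert (Hsplit : forall i, bcons zero i = bpair (bcons zero i) zero).
  { intros i; apply functional_extensionality; intros [|n]; auto.
    unfold bpair; destruct (Nat.even (S n)) eqn:E; auto.
    now destruct n as [|n]; [discriminate|]. }
  exists a, a; repeat split.
  - exact (HL x).
  - destruct (computable_index Hphi Hzero) as [j0 Hj0].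
    exists (bcons (bcons zero j) j0); split; [|split].
    + exists a; split; [now apply bpair_computable|reflexivity].
    + intros w Hw; apply Hin in Hw; destruct Hw as (i & -> & _).
      exists (bcons (bcons zero i) j0), (bcons zero i), zero, j0; auto.
    + exists (bcons zero j); split; [apply Hin; eauto|].
      exists (bcons zero j), zero, j0; auto.
  - intros r y Hr (_ & _ & w & Hw & Hy); cbn in Hr; subst y.
    apply Hin in Hw; destruct Hw as (i & -> & Hi).
    destruct Hy as (p & q & k & E & -> & _).
    rewrite Hsplit in E; apply bpair_inj in E; destruct E as [<- _].
    exists (fun _ => i), i; repeat split; auto.
    exact (HH (bcons (bcons zero i) k)).
Qed.

Lemma star_c_le_Goedel :
  sW_le (restr_c (Goedel_star_Goedel phi U)) (Goedel phi).
Proof.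
  destruct HU as ([cU HcU] & _ & _).
  assert (computes (fun _ : unit => no_oracle) (fun _ n => S (2 * right2 n)))
    as [cS HS] by computability.
  assert (computes seq_oracle (fun a n => a (S (2 * right2 n)))) as [cq Hq]
    by computability.
  assert (computes seq_oracle (fun a k => bpair (beven (beven a))
    (bcons (bodd (beven a)) (left2 k)) (right2 k))) as [cw Hw].
  { apply computes_bpair with (p := fun a _ => beven (beven a))
      (q := fun a k => bcons (bodd (beven a)) (left2 k));
      [computability|unfold beven; computability|].
    apply computes_bcons with (p := fun a _ => bodd (beven a));
      unfold bodd, beven; computability. }
  (* From the oracle [a], an instance, and the input [code2 i n], [cb] computes
     the value at [n] of what [U] returns if [i] is the first answer. *)
  pose (cb := relativize cw cU).
  assert (Hb : forall a i w,
    U (bpair (beven (beven a)) (bcons (bodd (beven a)) i)) w ->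
    forall n, eval (seq_oracle a) cb (code2 i n) (w n)).
  { intros a i w HUw n.
    apply eval_relativize with (2 := HcU _ _ HUw n).
    intros x y ->; specialize (Hw a (code2 i x)); now code2_simpl. }
  destruct (smn_operator Hphi cq) as (s1 & Hs1 & Hi).
  destruct (smn_operator Hphi (Comp cb (Pair Fst cS))) as (s2 & Hs2 & Hj).
  destruct (eval_from_index Hphi cb) as [c Hc].
  (* [fst z] is a name of an index of the instance, from which [s1] computes the
     first answer, and [snd z] is the result of [U]. *)
  pose (K := {z : baire * baire | forall n, eval no_oracle c
    (code2 (fst z 0) (code2 (s1 (code2 (fst z 0) 0)) n)) (snd z n)}).
  pose (O := fun z : K => seq_oracle (fst (proj1_sig z))).
  assert (computes O (fun z => bcons (beven (snd (proj1_sig z)))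
    (s2 (code2 (fst (proj1_sig z) 0) (s1 (code2 (fst (proj1_sig z) 0) 0))))))
    as [cH HH].
  { assert (computes O (fun z _ => fst (proj1_sig z) 0)) as H0.
    { apply computes_oracle with (q := fun z : K => fst (proj1_sig z)); auto.
      computability. }
    apply computes_bcons with (p := fun (z : K) _ => beven (snd (proj1_sig z)));
      [computability..|].
    apply computes_eval with c (fun z n => code2 (fst (proj1_sig z) 0)
      (code2 (s1 (code2 (fst (proj1_sig z) 0) 0)) (2 * pred n))); [|computability].
    intros [z Hz] n; apply Hz. }
  apply sW_le_of_programs with cH Oracle.
  intros a x Ha; cbn in x, Ha; subst x; intros [z ((p' & Hp' & Hp'a) & Hout & y & Hy & Hz)].
  cbn in Hp'a; subst p'.
  destruct Hy as (Hin & v & (p & q & i0 & -> & -> & Hi0) & HFv).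
  exists (bpair p q), (bpair p q); split; [intros n; reflexivity|].
  split; [reflexivity|split; [now apply computable_index|]].
  intros g e <- He; cbn in He.
  pose (i := s1 (code2 (g 0) 0)).
  assert (Hqi : Goedel phi q i).
  { rewrite <- (bodd_bpair p q).
    refine (Hi _ _ 0 (bodd (bpair p q)) He _).
    intros n; specialize (Hq (bpair p q) (code2 0 n)); now code2_simpl. }
  destruct (Hin (bcons p i)) as [w HFw]; [now exists p, q, i|].
  assert (Hinw : mv_comp (F_U U) (id_times_Goedel phi) (bpair p q) w).
  { split; auto; exists (bcons p i); split; auto; now exists p, q, i. }
  destruct HFw as (q' & r & i' & E & HUw).
  apply bcons_inj in E; destruct E as [-> <-].
  destruct (Hout w Hinw) as [w' (p2 & q2 & j0 & -> & -> & Hj0)].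
  specialize (Hb (bpair (bpair q' r) q) i (bpair p2 q2)).
  rewrite !beven_bpair, bodd_bpair in Hb; specialize (Hb HUw).
  assert (Hk : forall n, eval no_oracle c (code2 (g 0) (code2 i n)) (bpair p2 q2 n)).
  { intros n; exact (Hc _ _ He _ _ (Hb n)). }
  specialize (HH (exist _ (g, bpair p2 q2) Hk)); cbn in HH; fold i in HH.
  rewrite beven_bpair in HH.
  exists (bcons p2 (s2 (code2 (g 0) i))), (bcons p2 (s2 (code2 (g 0) i))).
  split; [exact HH|]; split; [reflexivity|]; split; [exists (bpair (bpair q' r) q); now split|].
  split; auto.
  exists (bpair p2 q2); split; auto; exists p2, q2, (s2 (code2 (g 0) i)).
  repeat split; auto.
  rewrite <- (bodd_bpair p2 q2).
  refine (Hj _ _ i (bodd (bpair p2 q2)) He _).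
  intros m; cbn [eval]; exists (code2 i (S (2 * m))); split.
  - exists i, (S (2 * m)); code2_simpl; repeat split; auto.
    specialize (HS tt (code2 i m)); code2_simpl.
    refine (eval_mono _ HS); intros ? ? [].
  - apply Hb.
Qed.

End CompositionalProduct.

(** * Topological separation from the parallelization *)

Section Separation.
Variable phi : nat -> pfun nat nat.
Hypothesis Hphi : acceptable phi.

(** A realizer may answer with any name of an index; one that uses a single name
    for each number leaves only countably many answers to defeat. *)
Lemma Goedel_constant_realizer : exists Gamma : pfun baire baire,
  realizes Gamma (Goedel phi) /\
  forall p q, Gamma p q -> exists i, q = constant i /\ Goedel phi p i.
Proof.
  unshelve eexists.
  - exists (fun p q => (exists i, Goedel phi p i) /\
      q = constant (epsilon (inhabits 0) (Goedel phi p))).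
    now intros p q r [_ ->] [_ ->].
  - split.
    + intros p x -> Hx; cbn in *.
      exists (constant (epsilon (inhabits 0) (Goedel phi x))),
        (epsilon (inhabits 0) (Goedel phi x)).
      repeat split; auto; exact (epsilon_spec _ _ Hx).
    + intros p q [Hp ->]; exists (epsilon (inhabits 0) (Goedel phi p)).
      split; auto; exact (epsilon_spec _ _ Hp).
Qed.

Definition update (p : baire) (m v : nat) : baire :=
  fun n => if n =? m then v else p n.

Lemma update_computable p m v : computable_seq p -> computable_seq (update p m v).
Proof.
  intros Hp; apply computable_seq_computes; unfold update; computability.
Qed.

Lemma avoid_index p m j : computable_seq p ->
  exists p', computable_seq p' /\ (forall n, n < m -> p' n = p n) /\
             ~ Goedel phi p' j.
Proof.
  intros Hp; destruct (classic (Goedel phi p j)) as [Hj|Hj].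
  - exists (update p m (S (p m))); split; [now apply update_computable|split].
    + intros n Hn; unfold update; destruct (Nat.eqb_spec n m); auto; lia.
    + intros Hj'; specialize (Hj m); specialize (Hj' m); cbn in Hj, Hj'.
      unfold update in Hj'; rewrite Nat.eqb_refl in Hj'.
      pose proof (graph_fun Hj Hj'); lia.
  - exists p; auto.
Qed.

Section Diagonalization.
Variable H : pfun baire baire.
Hypothesis HH : continuous H.

Definition agree (k : nat) (x x' : nat -> baire) := forall n, n < k -> x' n = x n.

(** The first [committed] sections are final; the others merely complete them to
    an admissible instance. *)
Record stage := Stage {
  sections : nat -> baire;
  committed : nat;
  sections_computable : forall n, computable_seq (sections n)
}.

(** [t] refutes the answer [i]: the list of indices that [H] may produce from [i] is
    wrong at the first section that [s] left open, for every admissible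
    instance that respects the commitments of [t]. *)
Definition defeats (i : nat) (s t : stage) : Prop :=
  committed s < committed t /\ agree (committed s) (sections s) (sections t) /\
  forall x q, agree (committed t) (sections t) x ->
    (forall n, computable_seq (x n)) ->
    H (bpair (btuple x) (constant i)) q ->
    ~ Goedel phi (x (committed s)) (q (code2 (committed s) 0)).

Lemma btuple_agree k x x' n : agree k x x' -> n < k -> btuple x' n = btuple x n.
Proof.
  intros Hx Hn; unfold btuple; rewrite Hx; auto.
  pose proof (left2_le n); lia.
Qed.

Lemma defeat i s : exists t, defeats i s t.
Proof.
  destruct s as [x k Hx]; unfold defeats; cbn.
  destruct (classic (exists y q, agree k x y /\ (forall n, computable_seq (y n)) /\
    H (bpair (btuple y) (constant i)) q)) as [(y & q & Hy & Hyc & Hq)|Hno].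
  - destruct (HH Hq (code2 k 0)) as [m Hm].
    destruct (@avoid_index (y k) m (q (code2 k 0)) (Hyc k)) as (p & Hpc & Hp & Hpj).
    set (z := fun n => if n =? k then p else y n).
    assert (Hzk : z k = p) by (unfold z; now rewrite Nat.eqb_refl).
    assert (Hz : forall n, n < m -> btuple z n = btuple y n).
    { intros n Hn; unfold btuple, z; destruct (Nat.eqb_spec (left2 n) k) as [->|]; auto.
      apply Hp.
      pose proof (code2_ge_right (left2 n) (right2 n)); code2_simpl; lia. }
    assert (Hzc : forall n, computable_seq (z n)).
    { intros n; unfold z; destruct (n =? k); auto. }
    (* The first [m] values of [btuple z] lie in sections below [m], so
       committing these sections fixes all that [H] has read. *)
    exists (Stage (S (k + m)) Hzc); cbn; split; [lia|split].
    + intros n Hn; unfold z; destruct (Nat.eqb_spec n k); [lia|auto].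
    + intros w r Hw _ Hr; rewrite Hw, Hzk by lia.
      rewrite (Hm _ _) with (2 := Hr); auto.
      intros n Hn; unfold bpair; destruct (Nat.even n); auto.
      pose proof (Nat.div2_decr n n).
      rewrite (btuple_agree Hw), Hz; auto; lia.
  - (* No admissible extension is in the domain of [H]: nothing to refute. *)
    exists (Stage (S k) Hx); cbn; split; [lia|split].
    + intros n _; reflexivity.
    + intros w r Hw Hwc Hr; exfalso; apply Hno; exists w, r; repeat split; auto.
      intros n Hn; apply Hw; lia.
Qed.

Definition next (i : nat) (s : stage) : stage :=
  proj1_sig (constructive_indefinite_description _ (defeat i s)).

Lemma next_spec i s : defeats i s (next i s).
Proof. unfold next; now destruct (constructive_indefinite_description _ _). Qed.

Fixpoint run (i : nat) : stage :=
  match i with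
  | 0 => Stage 0 (fun _ => constant_computable 0)
  | S i => next i (run i)
  end.

Lemma run_committed i : i <= committed (run i).
Proof.
  induction i; [lia|]; cbn [run].
  destruct (next_spec i (run i)) as [Hlt _]; lia.
Qed.

Lemma run_agree i j : i <= j ->
  committed (run i) <= committed (run j) /\
  agree (committed (run i)) (sections (run i)) (sections (run j)).
Proof.
  induction 1 as [|j _ [IHk IHa]]; [split; [auto|now intros ? ?]|].
  cbn [run]; destruct (next_spec j (run j)) as (Hlt & Ha & _).
  split; [lia|intros n Hn; rewrite Ha by lia; auto].
Qed.

(** Stage [S n] has committed more than [n] sections, so section [n] is final
    there. *)
Definition limit (n : nat) : baire := sections (run (S n)) n.

Lemma limit_agree i : agree (committed (run i)) (sections (run i)) limit.
Proof.
  intros n Hn; unfold limit.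
  destruct (Nat.le_ge_cases i (S n)) as [Hle|Hle].
  - now apply run_agree.
  - symmetry; apply run_agree; auto; pose proof (run_committed (S n)); lia.
Qed.

Lemma no_continuous_uniformization : exists x : nat -> baire,
  (forall n, computable_seq (x n)) /\
  forall i q, H (bpair (btuple x) (constant i)) q ->
    exists n, ~ Goedel phi (x n) (q (code2 n 0)).
Proof.
  exists limit; split; [intros n; apply sections_computable|].
  intros i q Hq; exists (committed (run i)).
  destruct (next_spec i (run i)) as (_ & _ & Hd).
  apply Hd; auto; [exact (@limit_agree (S i))|intros n; apply sections_computable].
Qed.

End Diagonalization.

Lemma parallelization_not_le_Goedel :
  ~ W_le_cont (parallelization (Goedel phi)) (Goedel phi).
Proof.
  intros (H & L & HH & _ & Hred).
  destruct Goedel_constant_realizer as (Gamma & HG & Hc).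
  destruct (no_continuous_uniformization HH) as (x & Hx & Hbad).
  destruct (Hred Gamma HG (btuple x) x) as (q & y & HF & Hq & Hy).
  - intros n; apply bsection_btuple.
  - exists (fun n => epsilon (inhabits 0) (Goedel phi (x n))); intros n.
    exact (epsilon_spec _ _ (computable_index Hphi (Hx n))).
  - destruct HF as (r & (p & g & -> & (l & _ & Hg) & ->) & HHq).
    apply Hc in Hg; destruct Hg as (i & -> & _).
    destruct (Hbad i q HHq) as [n Hn]; apply Hn.
    specialize (Hq n); cbn in Hq; unfold bsection in Hq; rewrite Hq; apply Hy.
Qed.

Definition total_pfun (F : baire -> baire) : pfun baire baire.
Proof. exists (fun p q => q = F p); now intros p q r -> ->. Defined.

Lemma Goedel_le_parallelization :
  W_le_cont (Goedel phi) (parallelization (Goedel phi)).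
Proof.
  exists (total_pfun (fun r => constant (bodd r (code2 0 0)))),
    (total_pfun (fun p => btuple (fun _ => p))).
  split; [|split].
  - intros r q -> n; exists (S (S (2 * code2 0 0))); intros r' q' Hr ->.
    apply Hr; lia.
  - intros p q -> n; exists (S (right2 n)); intros p' q' Hp ->; apply Hp; lia.
  - intros Gamma HG p x -> [i Hi].
    destruct (HG (btuple (fun _ => x)) (fun _ => x)) as (q & y & HGq & Hq & Hy).
    + intros n; apply bsection_btuple.
    + exists (fun _ => i); intros n; exact Hi.
    + exists (constant (q (code2 0 0))), (y 0); repeat split; [|exact (Hq 0)|apply Hy].
      exists (bpair x q); split; [|cbn; now rewrite bodd_bpair].
      exists x, q; repeat split; auto; exists (btuple (fun _ => x)); split; auto.
      reflexivity.
Qed.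

End Separation.

Theorem theorem25 (phi : nat -> pfun nat nat) (U : pfun baire baire)
    (Hphi : acceptable phi) (HU : universal U) :
  (sW_equiv (restr_c (parallelization (Goedel phi))) (Goedel phi) /\
   W_lt_cont (Goedel phi) (parallelization (Goedel phi))) /\
  sW_equiv (restr_c (Goedel_star_Goedel phi U)) (Goedel phi) /\
  sW_equiv (finite_parallelization (Goedel phi)) (Goedel phi).
Proof.
  repeat split.
  - now apply parallelization_c_le_Goedel.
  - now apply Goedel_le_parallelization_c.
  - apply Goedel_le_parallelization.
  - now apply parallelization_not_le_Goedel.
  - now apply star_c_le_Goedel.
  - now apply Goedel_le_star_c.
  - now apply finite_parallelization_le_Goedel.
  - apply Goedel_le_finite_parallelization.
Qed.
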